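(* Let $p\neq 3$ be an odd prime, let $a,b,c$ be nonzero elements of the prime field $\mathbb{F}_p$, and let $n\ge1$ be an integer. Let $\mathcal{C}$ be the projective non-singular curve of genus $1$ given by the equation $ax^3+by^3+cz^3=0$. Then (i) $\mathcal{C}$ is maximal over $\mathbb{F}_{p^{2n}}$ if and only if $3$ divides $p^n+1$; (ii) $\mathcal{C}$ is minimal over $\mathbb{F}_{p^{2n}}$ if and only if $3$ divides $p^n-1$ and $p\equiv 2\pmod 3$.
   Context: A projective, geometrically irreducible, non-singular algebraic curve $\mathcal{C}$ of genus $g$ defined over $\mathbb{F}_{Q^2}$ is called maximal over $\mathbb{F}_{Q^2}$ if it attains the Hasse-Weil upper bound, i.e. its number of $\mathbb{F}_{Q^2}$-rational points is $Q^2+1+2gQ$; it is called minimal over $\mathbb{F}_{Q^2}$ if it attains the Hasse-Weil lower bound, i.e. this number is $Q^2+1-2gQ$. *)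

(* Defs.v *)
From HB Require Import structures.
From mathcomp Require Import all_boot all_order all_algebra.
From mathcomp Require Import mpoly.

Set Implicit Arguments.
Unset Strict Implicit.
Unset Printing Implicit Defensive.

Import GRing.Theory.
Local Open Scope ring_scope.

(* Plane projective curves F = 0 in P^2, with F a ternary form over a field k.
   "Geometric" properties are quantified over all field extensions L of k
   (given by a ring morphism k -> L, as MathComp has no algebraic closure of
   an arbitrary field). *)

Definition irreducible_mpoly (L : fieldType) (F : {mpoly L[3]}) : Prop :=
  F \isn't a GRing.unit /\
  (forall G H : {mpoly L[3]},
     F = G * H -> G \is a GRing.unit \/ H \is a GRing.unit).

Definition geometrically_irreducible (k : fieldType) (F : {mpoly k[3]}) : Prop :=
  forall (L : fieldType) (f : {rmorphism k -> L}),
    irreducible_mpoly (map_mpoly f F).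

Definition nonsingular (k : fieldType) (F : {mpoly k[3]}) : Prop :=
  forall (L : fieldType) (f : {rmorphism k -> L}) (v : 'I_3 -> L),
    (exists i, v i != 0) -> (map_mpoly f F).@[v] = 0 ->
    exists i, ((map_mpoly f F)^`M(i)).@[v] != 0.

(* The genus g of the curve F = 0, read off from the Hilbert polynomial
     dim_k (k[X_0, X_1, X_2] / (F))_m = e * m + 1 - g    (m large)
   of its homogeneous coordinate ring (Hartshorne, I.7 and III Ex. 5.3).  This
   is the arithmetic genus, which for nonsingular geometrically irreducible
   curves, the only ones it is used for below, is the genus.
   I is the degree m component of the ideal (F). *)
Definition has_genus (k : fieldType) (F : {mpoly k[3]}) (g : nat) : Prop :=
  exists e m0 : nat, forall m : nat, (m0 <= m)%N ->
    exists2 I : {vspace dhomog 3 k m},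
      (forall G : dhomog 3 k m,
         G \in I <-> exists H : {mpoly k[3]}, mpoly_of_dhomog G = F * H) &
      (\dim (fullv : {vspace dhomog 3 k m}))%:Z - (\dim I)%:Z
        = e%:Z * m%:Z + 1 - g%:Z.

Record smooth_plane_curve (k : fieldType) (F : {mpoly k[3]}) (g : nat) : Prop :=
  SmoothPlaneCurve {
    spc_homog : exists d : nat, F \is d.-homog;
    spc_irred : geometrically_irreducible F;
    spc_nonsing : nonsingular F;
    spc_genus : has_genus F g
  }.

Section RationalPoints.
Variable K : finFieldType.

(* The point of P^2(K) with homogeneous coordinates v != 0, as the set of all
   its homogeneous coordinate vectors. *)
Definition proj_point (v : 'rV[K]_3) : {set 'rV[K]_3} :=
  [set t *: v | t : K & t != 0].

Definition rational_points (F : {mpoly K[3]}) : {set {set 'rV[K]_3}} :=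
  [set proj_point v | v : 'rV[K]_3
     & (v != 0) && (F.@[fun i => v 0 i] == 0)].

Definition maximal_curve (F : {mpoly K[3]}) : Prop :=
  exists Q g : nat,
    [/\ #|K| = (Q ^ 2)%N, smooth_plane_curve F g &
        #|rational_points F|%:Z = Q%:Z ^+ 2 + 1 + 2 * g%:Z * Q%:Z].

Definition minimal_curve (F : {mpoly K[3]}) : Prop :=
  exists Q g : nat,
    [/\ #|K| = (Q ^ 2)%N, smooth_plane_curve F g &
        #|rational_points F|%:Z = Q%:Z ^+ 2 + 1 - 2 * g%:Z * Q%:Z].

End RationalPoints.

Definition diagonal_cubic (k : fieldType) (a b c : k) : {mpoly k[3]} :=
  a *: 'X_0 ^+ 3 + b *: 'X_1 ^+ 3 + c *: 'X_2%R ^+ 3.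

(* Main.v *)
Require Import Defs.
From HB Require Import structures.
From mathcomp Require Import all_boot all_order all_algebra.
From mathcomp Require Import all_fingroup all_solvable all_field.
From mathcomp Require Import mpoly zify ring.

Set Implicit Arguments.
Unset Strict Implicit.
Unset Printing Implicit Defensive.

Import GRing.Theory.
Local Open Scope ring_scope.

(** Let q = #|K| = Q^2 with Q = p^n, and let N be the number of rational points
    of C.  The curve is smooth of genus 1: it is nonsingular because 3 is
    invertible, a factorization of the cubic would have a degree 1 factor
    ([diagonal_cubic_affine_factor]), and the Hilbert function of the coordinate
    ring is 3 m.  The Hilbert function determines the genus
    ([genus_unique]), so maximality means N = Q^2 + 1 + 2 Q and minimality means
    N = Q^2 + 1 - 2 Q.  The count N is recovered from the number 1 + (q - 1) N of
    affine solutions.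

    If p = 1 mod 3, the curve is ordinary and N is not 1 mod p, which excludes
    both values because p divides Q.  Indeed, as in the proof of the
    Chevalley-Warning theorem, 1 - N is congruent to minus the sum over K^3 of the
    (q - 1)-th powers of the cubic form.  Only one term of the multinomial
    expansion survives the summation, and its coefficient is prime to p
    ([prime_ndvd_trinomial]).

    If p = 2 mod 3, the curve is supersingular and N = Q^2 + 1 - 2 (-p)^n.  This is
    a statement about cubic Gauss sums that are, by Frobenius symmetry, rational
    integers of square q; the proof carries it out by counting.  As every element
    of F_p is a cube in F_p, it suffices to treat u^3 + v^3 + w^3 = 0.  Choose a
    generator g of the multiplicative group.  The numbers of solutions of
    u^3 + v^3 = y and u^3 + g v^3 = y depend only on the cubic class of y, and
    the Frobenius map swaps the classes of g and g^2, so that all of them are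
    affine functions of one integer h, with N = q + 1 - 2 h.  Counting the
    solutions of u^3 + v^3 + g w^3 = g^2 in two ways gives h^2 = q
    ([sqr_half_trace]), and since nonzero cubes have three cube roots, h = 1 mod 3
    ([dvd3_nsol2_1_g_1]).  Hence h = Q if Q = 1 mod 3 and h = - Q if Q = 2 mod 3. *)

(** * Geometry of the diagonal cubic *)

(** Summing over 'I_3 from an arbitrary starting index lets the three coordinates
    play symmetric roles in the proofs below. *)
Lemma sum_ord3 (V : nmodType) (i : 'I_3) (h : 'I_3 -> V) :
  \sum_j h j = h i + h (i + 1) + h (i + 2).
Proof.
rewrite !big_ord_recl big_ord0 addr0.
case: i => [[|[|[|//]]] ?]; rewrite /= addrA; [| rewrite -addrA addrC | rewrite addrC addrA];
do ![congr (_ + _)]; congr h; apply: val_inj => //=.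
Qed.

Definition cubic_coef (k : fieldType) (a b c : k) (i : 'I_3) : k :=
  nth 0 [:: a; b; c] i.

Lemma diagonal_cubicE (k : fieldType) (a b c : k) :
  diagonal_cubic a b c = \sum_i cubic_coef a b c i *: 'X_i ^+ 3.
Proof. by rewrite (sum_ord3 0). Qed.

Lemma map_diagonal_cubic (k L : fieldType) (f : {rmorphism k -> L}) (a b c : k) :
  map_mpoly f (diagonal_cubic a b c) = diagonal_cubic (f a) (f b) (f c).
Proof.
by rewrite /diagonal_cubic !rmorphD /= !map_mpolyZ !rmorphXn /= !map_mpolyX.
Qed.

Lemma diagonal_cubic_eval (k : fieldType) (a b c : k) (v : 'I_3 -> k) :
  (diagonal_cubic a b c).@[v] = a * v 0 ^+ 3 + b * v 1 ^+ 3 + c * v 2 ^+ 3.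
Proof. by rewrite /diagonal_cubic !mevalD !mevalZ !rmorphXn /= !mevalXU. Qed.

Lemma cubic_coef_neq0 (k : fieldType) (a b c : k) i :
  a != 0 -> b != 0 -> c != 0 -> cubic_coef a b c i != 0.
Proof. by case: i => [[|[|[|//]]] ?]. Qed.

Lemma diagonal_cubic_homog (k : fieldType) (a b c : k) :
  diagonal_cubic a b c \is 3.-homog.
Proof.
rewrite diagonal_cubicE; apply: rpred_sum => i _; apply: dhomogZ.
by apply: (dhomogMn (d := 1) 3); rewrite dhomogX /= mdeg1.
Qed.

Lemma mcoeff_diagonal_cubic (k : fieldType) (a b c : k) (i : 'I_3) :
  (diagonal_cubic a b c)@_(U_(i) *+ 3) = cubic_coef a b c i.
Proof.
rewrite diagonal_cubicE raddf_sum /= (bigD1 i) //= big1 => [|j ji].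
  by rewrite addr0 mcoeffZ mcoeffXn eqxx mulr1.
rewrite mcoeffZ mcoeffXn; case: eqP => [/mnmP/(_ i)|]; last by rewrite mulr0.
by rewrite !mulmnE !mnm1E eqxx (negPf ji).
Qed.

Lemma diagonal_cubic_neq0 (k : fieldType) (a b c : k) :
  a != 0 -> diagonal_cubic a b c != 0.
Proof.
apply: contraNneq => F0.
by rewrite -[a]/(cubic_coef a b c 0) -mcoeff_diagonal_cubic F0 mcoeff0.
Qed.

Lemma msize_dhomog (k : fieldType) n d (F : {mpoly k[n]}) :
  F != 0 -> F \is d.-homog -> msize F = d.+1.
Proof.
move=> nzF hF; rewrite mpolySpred //; congr _.+1.
exact: dhomog_uniq nzF (dhomog_msize hF) hF.
Qed.

Lemma msize2E (k : fieldType) n (G : {mpoly k[n]}) : (msize G <= 2)%N ->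
  G = (G@_0)%:MP + \sum_i G@_(U_(i)) *: 'X_i.
Proof.
move=> sG; apply/mpolyP => m.
rewrite mcoeffD mcoeffC raddf_sum /=.
under eq_bigr => i _ do rewrite mcoeffZ mcoeffX.
case dm: (mdeg m) => [|[|d]].
- move/eqP: dm; rewrite mdeg_eq0 => /eqP->; rewrite eqxx mulr1 big1 ?addr0 //.
  by move=> i _; rewrite -[_ == 0%MM]mdeg_eq0 mdeg1 mulr0.
- have /existsP[i /eqP->] : [exists i, m == U_(i)%MM] by rewrite -mdeg_eq1 dm.
  rewrite -mdeg_eq0 mdeg1 mulr0 add0r (bigD1 i) //= eqxx mulr1 big1 ?addr0 //.
  by move=> j ji; case: eqP => [/mnmP/(_ i)|]; rewrite ?mulr0 // !mnm1E eqxx (negPf ji).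
- rewrite [LHS]memN_msupp_eq0; last by apply: msize_mdeg_ge; rewrite dm (leq_trans sG).
  rewrite -mdeg_eq0 dm mulr0 add0r big1 // => i _.
  by case: eqP dm => [<-|]; rewrite ?mdeg1 ?mulr0.
Qed.

Lemma cube_affine_poly (L : fieldType) (u v : L) :
  (u *: 'X + v%:P) ^+ 3 = u ^+ 3 *: 'X^3 + (3%:R * u ^+ 2 * v) *: 'X^2
    + (3%:R * u * v ^+ 2) *: 'X + (v ^+ 3)%:P.
Proof.
rewrite -!mul_polyC !(polyCM (_ * _)) !(polyCM 3%:R) !polyC_exp polyC_natr.
by ring.
Qed.

(** On the zero locus of a degree 1 polynomial G with nonzero coefficient at X_i,
    X_i is an affine function of the other two variables.  Setting the last of
    them to 1 turns X_i into u * t + v and the cubic into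
    e_i (u t + v)^3 + e_j t^3 + e_k, which cannot vanish: its constant and t^3
    coefficients force u and v to be nonzero, and then 3 e_i u v^2 is nonzero. *)
Lemma diagonal_cubic_affine_factor (L : fieldType) (a b c : L) (G H : {mpoly L[3]}) :
  a != 0 -> b != 0 -> c != 0 -> 3%:R != 0 :> L ->
  diagonal_cubic a b c = G * H -> msize G <> 2%N.
Proof.
move=> a0 b0 c0 three0 FGH sG.
have GE := msize2E (eq_leq sG).
have [i ai0] : exists i : 'I_3, G@_(U_(i)) != 0.
  apply/existsP; rewrite -[[exists _, _]]negbK negb_exists.
  apply/negP => /forallP z.
  have : (msize G <= 1)%N.
    rewrite GE big1 => [|i _]; first by rewrite addr0 mmeasureC leq_b1.
    by move/negPn/eqP: (z i) ->; rewrite scale0r.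
  by rewrite sG.
have e0 j : cubic_coef a b c j != 0 by exact: cubic_coef_neq0.
set e := cubic_coef a b c in e0.
pose u := - G@_(U_(i+1)) / G@_(U_(i)); pose v := - (G@_(U_(i+2)) + G@_0) / G@_(U_(i)).
pose h (j : 'I_3) : {poly L} :=
  if j == i then u *: 'X + v%:P else if j == i + 1 then 'X else 1.
have [h0 h1 h2] : [/\ h i = u *: 'X + v%:P, h (i+1) = 'X & h (i+2) = 1].
  by rewrite /h; case: (i) => [[|[|[|//]]] ?].
have evG : mmap polyC h G = 0.
  rewrite GE rmorphD /= mmapC raddf_sum /= (sum_ord3 i) !mmapZ !mmapX !mmap1U h0 h1 h2.
  apply/polyP => j; rewrite !(coefD, coefC, coefZ, coefX, coefCM, coef0, mulr1) /u /v.
  by case: j => [|[|j]] /=; field.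
clearbody h u v.
have := congr1 (mmap polyC h) FGH; rewrite rmorphM /= evG mul0r.
rewrite diagonal_cubicE raddf_sum /= (sum_ord3 i) !mmapZ !rmorphXn /= !mmapX !mmap1U h0 h1 h2.
rewrite cube_affine_poly expr1n mulr1 => /polyP E.
have {E}E j := E j.
have := (E 0%N, E 1%N, E 3).
rewrite !(coefD, coefC, coefZ, coefX, coefXn, coefCM, coef0) /= -/e.
rewrite !(mulr0, mulr1, addr0, add0r) => -[[E0 E1] E3].
have u0 : u != 0.
  by apply: contraNneq (e0 (i + 1)) => u0; rewrite -E3 u0 expr0n mulr0 add0r.
have v0 : v != 0.
  by apply: contraNneq (e0 (i + 2)) => v0; rewrite -E0 v0 expr0n mulr0 add0r.
by move/eqP: E1; rewrite !mulf_eq0 (negPf (e0 i)) (negPf three0) (negPf u0) (negPf v0).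
Qed.

(** Degrees add up under multiplication, so a proper factorization of a cubic
    has a factor of degree 1. *)
Lemma diagonal_cubic_irreducible (L : fieldType) (a b c : L) :
  a != 0 -> b != 0 -> c != 0 -> 3%:R != 0 :> L ->
  irreducible_mpoly (diagonal_cubic a b c).
Proof.
move=> a0 b0 c0 three0.
have nzF := diagonal_cubic_neq0 b c a0.
have sF := msize_dhomog nzF (diagonal_cubic_homog a b c).
have unit1 (G : {mpoly L[3]}) : (msize G = 1)%N -> G \is a GRing.unit.
  by move/eqP/msize_poly1P=> [d d0 ->]; rewrite rmorph_unit // unitfE.
split.
  apply/negP => /unitrP[G [GF _]].
  have nzG : G != 0 by apply: contra_eqN GF => /eqP->; rewrite mul0r eq_sym oner_eq0.
  have := congr1 (fun P : {mpoly L[3]} => msize P) GF; rewrite msizeM // sF msize1.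
  by rewrite (mpolySpred _ nzG) !addnS.
move=> G H FGH.
have [nzG nzH] : G != 0 /\ H != 0.
  by apply/andP; rewrite -negb_or -mulf_eq0 -FGH.
have := congr1 (fun P : {mpoly L[3]} => msize P) FGH; rewrite sF msizeM //.
have FHG : diagonal_cubic a b c = H * G by rewrite mulrC.
have := diagonal_cubic_affine_factor a0 b0 c0 three0 FHG.
have := diagonal_cubic_affine_factor a0 b0 c0 three0 FGH.
have := unit1 G; have := unit1 H.
have : (0 < msize G)%N by rewrite lt0n msize_poly_eq0.
have : (0 < msize H)%N by rewrite lt0n msize_poly_eq0.
case: (msize G) => [|[|[|s]]] //; case: (msize H) => [|[|[|t]]] // _ _;
 by rewrite ?addnS ?addSn; auto.
Qed.

Lemma meval_mderiv_diagonal_cubic (L : fieldType) (a b c : L) (v : 'I_3 -> L) i :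
  ((diagonal_cubic a b c)^`M(i)).@[v] = 3%:R * cubic_coef a b c i * v i ^+ 2.
Proof.
have D e (j : 'I_3) :
    ((e *: 'X_j ^+ 3)^`M(i)).@[v] = if j == i then 3%:R * e * v i ^+ 2 else 0.
  rewrite mpolyXn mderivZ mderivX !mevalZ mevalX mulmnE mnm1E.
  have [->|_] := eqVneq j i; last by rewrite mul0r mulr0.
  rewrite (bigD1 i) //= big1 => [|l /negPf li].
    by rewrite mnmBE mulmnE !mnm1E eqxx /= mulr1; ring.
  by rewrite mnmBE mulmnE !mnm1E eq_sym li expr0.
rewrite diagonal_cubicE (sum_ord3 i) !mderivD !mevalD !D eqxx.
have [-> ->] : (i + 1 == i) = false /\ (i + 2 == i) = false.
  by case: (i) => [[|[|[|//]]] ?].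
by rewrite !addr0.
Qed.

Lemma diagonal_cubic_nonsingular (k : fieldType) (a b c : k) :
  a != 0 -> b != 0 -> c != 0 -> 3%:R != 0 :> k ->
  nonsingular (diagonal_cubic a b c).
Proof.
move=> a0 b0 c0 three0 L f v [i vi0] _; exists i.
rewrite map_diagonal_cubic meval_mderiv_diagonal_cubic.
rewrite !mulf_neq0 ?expf_neq0 //; first by rewrite -(rmorph_nat f) fmorph_eq0.
by apply: cubic_coef_neq0; rewrite fmorph_eq0.
Qed.

Lemma dim_dhomog (k : fieldType) n d :
  \dim (fullv : {vspace dhomog n.+1 k d}) = 'C(d + n, d).
Proof. by rewrite dimvf. Qed.

(** The cofactor of a form in another form may be taken homogeneous, so each
    homogeneous component of the ideal (F) is the image of a space of forms under
    multiplication by F. *)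
Lemma dhomog_factor (k : fieldType) n (F H : {mpoly k[n]}) d e :
  F \is d.-homog -> F * H \is (d + e).-homog ->
  F * H = F * pihomog mdeg e H.
Proof.
move=> hF hFH; pose N := maxn (msize H) e.+1.
have HE := pihomog_partitionE (leq_maxl (msize H) e.+1).
rewrite -[LHS](pihomog_dE hFH) {1}HE mulr_sumr raddf_sum /=.
have eN : (e < N)%N by rewrite leq_maxr.
rewrite (bigD1 (Ordinal eN)) //= big1 => [|j ji].
  by rewrite addr0 pihomog_dE //; apply: dhomogM => //; apply: pihomogP.
apply: (pihomog_ne0 (d := d + j)); first by rewrite eqn_add2l.
by apply: dhomogM => //; apply: pihomogP.
Qed.

Section MulForm.
Variables (k : fieldType) (F : {mpoly k[3]}) (d e : nat).
Hypothesis hF : F \is d.-homog.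

Fact mul_form_subproof (H : dhomog 3 k e) : F * mpoly_of_dhomog H \is (d + e).-homog.
Proof. by apply: dhomogM => //; apply: dhomog_is_dhomog. Qed.

Definition mul_form (H : dhomog 3 k e) : dhomog 3 k (d + e) :=
  DHomog (mul_form_subproof H).

Fact mul_form_is_linear : linear mul_form.
Proof.
by move=> s G H; apply: val_inj; rewrite /= mulrDr scalerAr.
Qed.

HB.instance Definition _ :=
  GRing.isLinear.Build k (dhomog 3 k e) (dhomog 3 k (d + e)) _ mul_form
    mul_form_is_linear.

Lemma dim_limg_mul_form : F != 0 -> \dim (limg (linfun mul_form)) = 'C(e + 2, e).
Proof.
move=> nzF; rewrite limg_dim_eq ?dim_dhomog //; apply/eqP.
rewrite -subv0; apply/subvP => H; rewrite memv_cap memvf memv_ker lfunE memv0.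
move=> /eqP /(congr1 (@mpoly_of_dhomog _ _ _)) FH0; apply/eqP/val_inj.
by have /eqP := FH0 : F * H = 0; rewrite mulf_eq0 (negPf nzF) => /eqP.
Qed.

Lemma mem_limg_mul_form (G : dhomog 3 k (d + e)) :
  G \in limg (linfun mul_form) <-> exists H, mpoly_of_dhomog G = F * H.
Proof.
split=> [/memv_imgP[H _ ->]|[H GFH]]; first by exists (mpoly_of_dhomog H); rewrite lfunE.
apply/memv_imgP; exists (DHomog (pihomogP mdeg e H)); first exact: memvf.
rewrite lfunE; apply: val_inj; rewrite /= GFH.
by apply: (dhomog_factor hF); rewrite -GFH; exact: dhomog_is_dhomog.
Qed.

End MulForm.

(** For m = e + 3 the Hilbert function is C(e + 5, 2) - C(e + 2, 2) = 3 m,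
    which is 3 m + 1 - g for g = 1. *)
Lemma diagonal_cubic_genus (k : fieldType) (a b c : k) :
  a != 0 -> has_genus (diagonal_cubic a b c) 1.
Proof.
move=> a0; exists 3, 3 => m /subnKC; move: (m - 3)%N => e <- {m}.
exists (limg (linfun (mul_form (e := e) (diagonal_cubic_homog a b c)))).
  exact: mem_limg_mul_form.
rewrite dim_limg_mul_form ?diagonal_cubic_neq0 // dim_dhomog.
have b2 i : 'C(i + 2, i) = 'C(i.+2, 2) by rewrite addnC -bin_sub ?leq_addl // addnK.
rewrite !b2 !addSn add0n !binS !bin0 !bin1 !PoszD; lia.
Qed.

(** The degree m component I of the ideal is determined by F, so two Hilbert polynomials for
    F agree at two consecutive large integers; equality of their slopes, and
    then of their constant terms, follows. *)
Lemma genus_unique (k : fieldType) (F : {mpoly k[3]}) g h :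
  has_genus F g -> has_genus F h -> g = h.
Proof.
move=> [e [m0 He]] [f [m1 Hf]].
have D m : (maxn m0 m1 <= m)%N ->
   e%:Z * m%:Z + 1 - g%:Z = f%:Z * m%:Z + 1 - h%:Z.
  rewrite geq_max => /andP[/He[I memI <-] /Hf[J memJ <-]].
  suff -> : I = J by [].
  by apply/vspaceP => G; apply/idP/idP; [rewrite memI memJ | rewrite memI memJ].
have := D _ (leqnn _); have := D _ (leqnSn _).
nia.
Qed.

Lemma smooth_diagonal_cubic (k : fieldType) (a b c : k) :
  a != 0 -> b != 0 -> c != 0 -> 3%:R != 0 :> k ->
  smooth_plane_curve (diagonal_cubic a b c) 1.
Proof.
move=> a0 b0 c0 three0; split.
- by exists 3; exact: diagonal_cubic_homog.
- move=> L f; rewrite map_diagonal_cubic.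
  by apply: diagonal_cubic_irreducible; rewrite -?(rmorph_nat f) fmorph_eq0.
- exact: diagonal_cubic_nonsingular.
- exact: diagonal_cubic_genus.
Qed.

(** * Finite fields *)

Lemma card_pred_gt0 (K : finFieldType) : (0 < #|K|.-1)%N.
Proof. by rewrite -subn1 subn_gt0 finNzRing_gt1. Qed.

Lemma card_neq0 (K : finFieldType) : #|[pred x : K | x != 0]| = #|K|.-1.
Proof. by rewrite -(cardC1 (0 : K)); apply: eq_card => x; rewrite !inE. Qed.

Lemma expf_card_pred (K : finFieldType) (x : K) : x != 0 -> x ^+ #|K|.-1 = 1.
Proof.
move=> x0; apply: (mulfI x0).
by rewrite -exprS prednK ?expf_card ?mulr1 //; apply/card_gt0P; exists 0.
Qed.

Lemma finField_generator (K : finFieldType) : exists g : K,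
  [/\ g != 0, forall y, y != 0 -> exists k, y = g ^+ k &
      forall j, (g ^+ j == 1) = (#|K|.-1 %| j)%N].
Proof.
have /cyclicP[x Ux] := field_unit_group_cyclic [set: {unit K}].
exists (FinRing.uval x); split=> [|y y0|j].
- by rewrite -unitfE; exact: valP x.
- have Uy : y \is a GRing.unit by rewrite unitfE.
  have : FinRing.unit K Uy \in <[x]>%g by rewrite -Ux inE.
  by case/cycleP => k /(congr1 (@FinRing.uval K)); rewrite FinRing.val_unitX; exists k.
- by rewrite -card_finField_unit Ux order_dvdn -FinRing.val_unitX.
Qed.

(** * Projective points and affine solutions *)

Section CountPoints.
Variable K : finFieldType.
Implicit Types (v w : 'rV[K]_3) (F : {mpoly K[3]}).

Lemma proj_point_id v : v \in proj_point v.
Proof. by apply/imsetP; exists 1; rewrite ?scale1r // inE oner_eq0. Qed.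

Lemma eq_proj_point v w : (proj_point v == proj_point w) = (v \in proj_point w).
Proof.
apply/eqP/idP => [<-|/imsetP[t]]; first exact: proj_point_id.
rewrite inE => t0 ->; apply/setP => x; apply/imsetP/imsetP => -[s]; rewrite inE => s0 ->.
  by exists (s * t); rewrite ?scalerA // inE mulf_neq0.
by exists (s / t); rewrite ?inE ?mulf_neq0 ?invr_eq0 // scalerA divfK.
Qed.

Lemma card_proj_point v : v != 0 -> #|proj_point v| = #|K|.-1.
Proof.
move=> v0; rewrite card_imset => [|s t /eqP].
  by rewrite -card_neq0; apply: eq_card => t; rewrite !inE.
by rewrite -subr_eq0 -scalerBl scaler_eq0 (negPf v0) orbF subr_eq0 => /eqP.
Qed.

(** The points of P^2 partition the nonzero vectors into scalar orbits, each of
    size #|K| - 1. *)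
Lemma card_cone (A : {set 'rV[K]_3}) : 0 \notin A ->
  (forall t v, t != 0 -> v \in A -> t *: v \in A) ->
  #|A| = (#|K|.-1 * #|[set proj_point v | v in A]|)%N.
Proof.
move=> A0 stabA; rewrite -sum1_card (partition_big_imset (@proj_point K)) /=.
rewrite mulnC -sum_nat_const; apply: eq_bigr => _ /imsetP[w Aw ->].
rewrite sum1dep_card -(@card_proj_point w); last by apply: contraNneq A0 => <-.
apply: eq_card => v; rewrite inE eq_proj_point andb_idl //.
by case/imsetP => t; rewrite inE => t0 ->; apply: stabA.
Qed.

Definition affine_solutions (a b c : K) : nat :=
  (\sum_x \sum_y \sum_z ((a * x ^+ 3 + b * y ^+ 3 + c * z ^+ 3 == 0)%R : nat))%N.

Lemma card_rational_points (a b c : K) :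
  affine_solutions a b c =
    (1 + #|K|.-1 * #|rational_points (diagonal_cubic a b c)|)%N.
Proof.
set F := diagonal_cubic a b c.
pose A : {set 'rV[K]_3} := [set v : 'rV[K]_3 | F.@[fun i => v 0 i] == 0].
have FE (v : 'rV[K]_3) : F.@[fun i => v 0 i] = a * v 0 0 ^+ 3 + b * v 0 1 ^+ 3 + c * v 0 2 ^+ 3.
  by rewrite diagonal_cubic_eval.
have A0 : 0 \in A by rewrite inE FE !mxE !expr0n /= !mulr0 !addr0.
transitivity #|A|.
  pose h (t : K * K * K) : 'rV[K]_3 := \row_i nth 0 [:: t.1.1; t.1.2; t.2] i.
  rewrite -sum1_card (reindex h) /=; last first.
    exists (fun v : 'rV[K]_3 => (v 0 0, v 0 1, v 0 2)).
      by move=> [[x y] z] _; rewrite /h !mxE.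
    by move=> v _; apply/rowP => -[[|[|[|//]]] ?]; rewrite !mxE /=;
      congr (v 0 _); apply: val_inj.
  rewrite /affine_solutions pair_bigA pair_bigA /= [RHS]big_mkcond /=.
  by apply: eq_bigr => -[[x y] z] _; rewrite inE FE !mxE /=; case: ifP.
rewrite (cardsD1 0) A0; congr (_ + _)%N.
rewrite card_cone; first 1 last.
- by rewrite !inE eqxx.
- move=> t v t0; rewrite !inE scaler_eq0 negb_or t0 /= => /andP[-> /eqP].
  rewrite !FE !mxE => E; apply/eqP; rewrite -[RHS](mulr0 (t ^+ 3)) -E; ring.
congr (_ * _)%N; apply: eq_card => P.
by apply/imsetP/imsetP => -[v Av ->]; exists v => //; move: Av; rewrite !inE.
Qed.

End CountPoints.

(** * The ordinary case: counting modulo p *)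

Section PowerSums.
Variable K : finFieldType.

(** Translation by 1 permutes K, so the sum of all x equals that sum plus #|K|. *)
Lemma natr_card : #|K|%:R = 0 :> K.
Proof.
have := reindex_inj (addIr 1) : \sum_(x : K) x = \sum_(x : K) (x + 1).
rewrite big_split /= sumr_const => /esym/eqP.
by rewrite -subr_eq0 addrAC subrr add0r => /eqP.
Qed.

Lemma natr_card_pred : #|K|.-1%:R = -1 :> K.
Proof.
apply/eqP; rewrite -subr_eq0 opprK natr1 prednK ?natr_card //.
by apply/card_gt0P; exists 0.
Qed.

(** Multiplication by a generator g permutes K, so the sum is g^j times itself. *)
Lemma sum_expr_eq0 (j : nat) : (j == 0)%N || ~~ (#|K|.-1 %| j)%N ->
  \sum_(x : K) x ^+ j = 0.
Proof.
case/orP => [/eqP->|nj].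
  by under eq_bigr do rewrite expr0; rewrite sumr_const natr_card.
have [g [g0 _ gj]] := finField_generator K.
have := reindex_inj (mulfI g0) : \sum_(x : K) x ^+ j = \sum_(x : K) (g * x) ^+ j.
under [in RHS]eq_bigr do rewrite exprMn.
rewrite -mulr_sumr -[LHS]mul1r => /eqP; rewrite -subr_eq0 -mulrBl mulf_eq0.
by rewrite subr_eq0 eq_sym gj (negPf nj) => /eqP.
Qed.

Lemma sum_expr_card_pred : \sum_(x : K) x ^+ #|K|.-1 = -1.
Proof.
have K1 := card_pred_gt0 K.
rewrite (bigD1 0) //= expr0n eqn0Ngt K1 add0r -natr_card_pred.
rewrite (eq_bigr (fun=> 1)) => [|x x0].
  by rewrite sumr_const -card_neq0.
exact: expf_card_pred.
Qed.

Lemma natr_eq0 (y : K) : (y == 0)%:R = 1 - y ^+ #|K|.-1.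
Proof.
have K1 := card_pred_gt0 K.
have [->|y0] := eqVneq; first by rewrite expr0n eqn0Ngt K1 subr0.
by rewrite expf_card_pred // subrr.
Qed.

Lemma natr_affine_solutions (a b c : K) : (affine_solutions a b c)%:R =
  - \sum_x \sum_y \sum_z (a * x ^+ 3 + b * y ^+ 3 + c * z ^+ 3) ^+ #|K|.-1.
Proof.
rewrite /affine_solutions natr_sum -sumrN; apply: eq_bigr => x _.
transitivity (\sum_(y : K) (#|K|%:R - \sum_z (a * x ^+ 3 + b * y ^+ 3 + c * z ^+ 3) ^+ #|K|.-1)).
  rewrite natr_sum; apply: eq_bigr => y _.
  rewrite natr_sum -sumr_const -sumrB; apply: eq_bigr => z _; exact: natr_eq0.
by rewrite -sumrN; apply: eq_bigr => y _; rewrite natr_card sub0r.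
Qed.

(** Expanding by the multinomial theorem, the monomials x^(3i) y^(3j) z^(3k) have
    i + j + k = #|K| - 1 = 3 m.  A power sum vanishes unless its exponent is a
    positive multiple of 3 m, and only i = j = k = m satisfies this three times. *)
Lemma sum_diagonal_cubic_expr (a b c : K) m : #|K|.-1 = (3 * m)%N ->
  \sum_x \sum_y \sum_z (a * x ^+ 3 + b * y ^+ 3 + c * z ^+ 3) ^+ #|K|.-1 =
  - ('C(3 * m, m) * 'C(2 * m, m))%:R * (a * b * c) ^+ m.
Proof.
move=> Em.
have K1 := card_pred_gt0 K.
pose P j : K := \sum_(x : K) x ^+ (3 * j).
have P0 j : (j == 0)%N || ~~ (m %| j)%N -> P j = 0.
  by rewrite /P => Hj; apply: sum_expr_eq0; rewrite Em muln_eq0 dvdn_pmul2l.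
have Pm : P m = -1 by rewrite /P -Em sum_expr_card_pred.
pose M := #|K|.-1.
(* P j is a power sum, and co i j collects the coefficient of the monomial
   x^(3(M - i - j)) y^(3j) z^(3i). *)
pose co (i j : nat) : K :=
  ('C(M, i) * 'C(M - i, j))%:R * (a ^+ (M - i - j) * b ^+ j * c ^+ i).
transitivity (\sum_(i < M.+1) \sum_(j < (M - i).+1) co i j * (P (M - i - j)%N * P j * P i)).
  rewrite (eq_bigr (fun x : K => \sum_(i < M.+1) \sum_(j < (M - i).+1)
      co i j * (x ^+ (3 * (M - i - j)) * P j * P i))) => [|x _].
    rewrite exchange_big; apply: eq_bigr => i _ /=.
    rewrite exchange_big; apply: eq_bigr => j _ /=.
    by rewrite -mulr_sumr -!mulr_suml.
  rewrite (eq_bigr (fun y : K => \sum_(i < M.+1) \sum_(j < (M - i).+1)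
      co i j * (x ^+ (3 * (M - i - j)) * y ^+ (3 * j) * P i))) => [|y _].
    rewrite exchange_big; apply: eq_bigr => i _ /=.
    rewrite exchange_big; apply: eq_bigr => j _ /=.
    by rewrite -mulr_sumr -!mulr_suml -mulr_sumr.
  rewrite (eq_bigr (fun z : K => \sum_(i < M.+1) \sum_(j < (M - i).+1)
      co i j * (x ^+ (3 * (M - i - j)) * y ^+ (3 * j) * z ^+ (3 * i)))) => [|z _].
    rewrite exchange_big; apply: eq_bigr => i _ /=.
    rewrite exchange_big; apply: eq_bigr => j _ /=.
    by rewrite -!mulr_sumr.
  rewrite exprDn; apply: eq_bigr => i _.
  rewrite exprDn mulr_suml -sumrMnl; apply: eq_bigr => j _.
  rewrite /co -(mulr_natr _ 'C(_, i)) -(mulr_natr _ 'C(_, j)) natrM (exprMn _ a) (exprMn _ b) (exprMn _ c) !(exprM _ 3) /M.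
  move: (a ^+ _) (b ^+ _) (c ^+ _) (x ^+ _ ^+ _) (y ^+ _ ^+ _) (z ^+ _ ^+ _) => *; ring.
have zero (i j : nat) : (i <= M)%N -> (j <= M - i)%N -> (i != m) || (j != m) ->
    co i j * (P (M - i - j)%N * P j * P i) = 0.
  move=> iM jM ij.
  have [/P0->|] := boolP ((i == 0)%N || ~~ (m %| i)%N); first by rewrite !mulr0.
  rewrite negb_or negbK => /andP[i0 /dvdnP[i' Ei]].
  have [/P0->|] := boolP ((j == 0)%N || ~~ (m %| j)%N); first by rewrite mulr0 mul0r mulr0.
  rewrite negb_or negbK => /andP[j0 /dvdnP[j' Ej]].
  have [/P0->|] := boolP ((M - i - j == 0)%N || ~~ (m %| M - i - j)%N); first by rewrite !mul0r mulr0.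
  rewrite negb_or negbK => /andP[k0 /dvdnP[k' Ek]].
  have m0 : (0 < m)%N by rewrite lt0n; apply: contraNneq i0 => m0; rewrite Ei m0 muln0.
  have E3 : (i' + j' + k' = 3)%N.
    apply/eqP; rewrite -(eqn_pmul2r m0) !mulnDl -Ei -Ej -Ek -Em -/M.
    by apply/eqP; lia.
  have i'0 : (0 < i')%N by rewrite lt0n; apply: contraNneq i0 => z; rewrite Ei z.
  have j'0 : (0 < j')%N by rewrite lt0n; apply: contraNneq j0 => z; rewrite Ej z.
  have k'0 : (0 < k')%N by rewrite lt0n; apply: contraNneq k0 => z; rewrite Ek z.
  have [i1 j1] : i' = 1%N /\ j' = 1%N by lia.
  by move: ij; rewrite Ei Ej i1 j1 mul1n eqxx.
have ME : M = (3 * m)%N := Em.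
have mM : (m < M.+1)%N by rewrite ME; lia.
have mM' : (m < (M - m).+1)%N by rewrite ME; lia.
rewrite (bigD1 (Ordinal mM)) //= (bigD1 (Ordinal mM')) //= big1 ?addr0 => [|j jm]; last first.
  apply: zero; [by rewrite -ltnS | by rewrite -ltnS (ltn_ord j) | ].
  by apply/orP; right; apply: contraNneq jm => E; apply/eqP/val_inj.
rewrite big1 ?addr0 => [|i im]; last first.
  rewrite big1 // => j _; apply: zero; [by rewrite -ltnS (ltn_ord i) | by rewrite -ltnS (ltn_ord j) | ].
  by apply/orP; left; apply: contraNneq im => E; apply/eqP/val_inj.
have E2 : (M - m = 2 * m)%N by rewrite ME; lia.
have E1 : (M - m - m = m)%N by rewrite ME; lia.
rewrite /co E1 E2 ME Pm !exprMn; ring.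
Qed.

End PowerSums.

Lemma multinomial3 m : ('C(3 * m, m) * 'C(2 * m, m) * (m`! * m`! * m`!) = (3 * m)`!)%N.
Proof.
have H1 := @bin_fact (3 * m) m; have H2 := @bin_fact (2 * m) m.
have -> : (m`! * m`! * m`! = m`! * (m`! * m`!))%N by rewrite mulnA.
have E : (3 * m - m = 2 * m)%N by lia.
have E' : (2 * m - m = m)%N by lia.
rewrite E in H1; rewrite E' in H2; rewrite -H1; last by lia.
rewrite -H2; last by lia.
nia.
Qed.

(** The trinomial coefficient (3m)!/(m!)^3 is prime to p because adding three
    copies of m = (p^N - 1)/3 in base p produces no carry: every digit of m is
    (p - 1)/3.  Legendre's formula expresses this as floor(3m / p^k) =
    3 floor(m / p^k) for every k. *)
Lemma prime_ndvd_trinomial p N m : prime p -> p = 1 %[mod 3] -> (p ^ N = (3 * m).+1)%N ->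
  ~~ (p %| 'C(3 * m, m) * 'C(2 * m, m))%N.
Proof.
move=> p_pr p1 pN.
have pk k : (p ^ k = 1 %[mod 3])%N by rewrite -modnXm p1 modnXm exp1n.
have lf : (logn p (3 * m)`! = 3 * logn p m`!)%N.
  rewrite !logn_fact // big_distrr /=.
  (* The terms with k > m vanish on both sides, since then p^k > 3 m. *)
  rewrite [RHS](big_nat_widen _ _ (3 * m).+1); last by lia.
  rewrite [RHS]big_mkcond /=; apply: eq_big_nat => k _.
  case: leqP => [mk|km]; last first.
    have [kN|Nk] := leqP k N; last first.
      have : (p ^ N < p ^ k)%N by rewrite ltn_exp2l ?prime_gt1.
      by rewrite pN => h; rewrite !divn_small //; lia.
    have := divn_eq (p ^ k) 3; have := divn_eq (p ^ (N - k)) 3.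
    rewrite !pk => E2 E1.
    (* Now p^k = 3 r + 1 and p^(N - k) = 3 s + 1, which gives m = s p^k + r. *)
    set r := (_ %/ 3)%N in E1; set s := (_ %/ 3)%N in E2.
    have E : ((p ^ (N - k)) * p ^ k = (3 * m).+1)%N by rewrite -expnD subnK.
    rewrite E2 mulnDl mul1n in E.
    have pk0 : (0 < p ^ k)%N by rewrite expn_gt0 prime_gt0.
    have -> : (3 * m = (3 * s) * p ^ k + (p ^ k).-1)%N by nia.
    have -> : (m = s * p ^ k + r)%N by nia.
    rewrite !divnMDl // !divn_small ?addn0 //; lia.
  rewrite divn_small //.
  have p4 : (3 < p)%N by have := prime_gt1 p_pr; case: (p) p1 => [|[|[|[|]]]].
  have : (p ^ m.+1 <= p ^ k)%N by rewrite leq_exp2l ?prime_gt1.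
  apply: leq_trans; rewrite expnS.
  have := ltn_expl m (prime_gt1 p_pr); nia.
have := congr1 (logn p) (multinomial3 m); rewrite lf.
have A0 : (0 < 'C(3 * m, m) * 'C(2 * m, m))%N by rewrite muln_gt0 !bin_gt0; lia.
have L : logn p (m`! * m`! * m`!)%N = (3 * logn p m`!)%N.
  by rewrite !lognM ?muln_gt0 ?fact_gt0 //; lia.
rewrite (lognM _ A0) ?muln_gt0 ?fact_gt0 // L => E.
rewrite -[X in (X %| _)%N]expn1 pfactor_dvdn // -leqNgt; lia.
Qed.

(** This is the nonvanishing of the Hasse invariant of the curve. *)
Lemma affine_solutions_ordinary (K : finFieldType) (a b c : K) p N :
  prime p -> p = 1 %[mod 3] -> #|K| = (p ^ N)%N ->
  a != 0 -> b != 0 -> c != 0 -> (affine_solutions a b c)%:R != 0 :> K.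
Proof.
move=> p_pr p1 cK a0 b0 c0.
have pN1 : (p ^ N)%N = 1 %[mod 3] by rewrite -modnXm p1 modnXm exp1n.
have pN : (p ^ N)%N = (3 * (p ^ N %/ 3)).+1.
  by rewrite {1}(divn_eq (p ^ N) 3) pN1 addn1 mulnC.
set m := (_ %/ 3)%N in pN.
have Em : #|K|.-1 = (3 * m)%N by rewrite cK pN.
rewrite natr_affine_solutions (sum_diagonal_cubic_expr a b c Em) mulNr opprK.
rewrite mulf_neq0 ?expf_neq0 ?mulf_neq0 //.
by rewrite -(dvdn_pcharf (card_finPcharP cK p_pr)) (prime_ndvd_trinomial p_pr p1 pN).
Qed.

(** * The supersingular case: cubic classes *)

Section CubicCounts.
Variable K : finFieldType.
Implicit Types (a b c t y z : K).

Definition nsol1 (a y : K) : nat := (\sum_u ((a * u ^+ 3 == y)%R : nat))%N.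
Definition nsol2 (a b y : K) : nat :=
  (\sum_u \sum_v ((a * u ^+ 3 + b * v ^+ 3 == y)%R : nat))%N.

Arguments nsol1 (a y)%_R.
Arguments nsol2 (a b y)%_R.

Lemma nsol2E1 a b y : nsol2 a b y = (\sum_v nsol1 a (y - b * v ^+ 3)%R)%N.
Proof.
rewrite /nsol2 exchange_big; apply: eq_bigr => v _; apply: eq_bigr => u _.
by rewrite -subr_eq opprK.
Qed.

Lemma nsol2C a b y : nsol2 a b y = nsol2 b a y.
Proof.
rewrite /nsol2 exchange_big; apply: eq_bigr => v _; apply: eq_bigr => u _.
by rewrite addrC.
Qed.

Lemma nsol2_cubel t a b y : t != 0 -> nsol2 (a * t ^+ 3) b y = nsol2 a b y.
Proof.
move=> t0; rewrite /nsol2 [RHS](reindex_inj (mulfI t0)) /=; apply: eq_bigr => u _.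
by apply: eq_bigr => v _; rewrite exprMn -mulrA.
Qed.

Lemma nsol2_scale s a b y : s != 0 -> nsol2 (s * a) (s * b) (s * y) = nsol2 a b y.
Proof.
move=> s0; rewrite /nsol2; apply: eq_bigr => u _; apply: eq_bigr => v _.
by rewrite -!mulrA -mulrDr (inj_eq (mulfI s0)).
Qed.

Lemma nsol2_cuber t a b y : t != 0 -> nsol2 a b (y * t ^+ 3) = nsol2 a b y.
Proof.
move=> t0; have t30 : t ^+ 3 != 0 by rewrite expf_neq0.
rewrite -(nsol2_cubel a _ _ t0) nsol2C -(nsol2_cubel b _ _ t0) nsol2C.
by rewrite ![_ * t ^+ 3]mulrC nsol2_scale.
Qed.

Lemma nsol1_scale s a y : s != 0 -> nsol1 (s * a) (s * y) = nsol1 a y.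
Proof.
by move=> s0; rewrite /nsol1; apply: eq_bigr => u _; rewrite -mulrA (inj_eq (mulfI s0)).
Qed.

Lemma nsol1_cuber t a y : t != 0 -> nsol1 a (y * t ^+ 3) = nsol1 a y.
Proof.
move=> t0; rewrite /nsol1 (reindex_inj (mulfI t0)) /=; apply: eq_bigr => u _.
by rewrite exprMn mulrCA [y * _]mulrC (inj_eq (mulfI _)) // expf_neq0.
Qed.

Lemma nsol1_cubel t a y : t != 0 -> nsol1 (a * t ^+ 3) y = nsol1 a y.
Proof.
move=> t0; rewrite /nsol1 [RHS](reindex_inj (mulfI t0)) /=; apply: eq_bigr => u _.
by rewrite exprMn -mulrA.
Qed.

Lemma nsol1_0 a : a != 0 -> nsol1 a 0 = 1%N.
Proof.
move=> a0; rewrite /nsol1 (bigD1 0) //= expr0n mulr0 eqxx big1 // => u /negPf u0.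
by rewrite mulf_eq0 (negPf a0) expf_eq0 u0.
Qed.

Lemma nsol1_eq0 a y : (forall t, a * t ^+ 3 != y) -> nsol1 a y = 0%N.
Proof. by move=> h; apply: big1 => u _; rewrite (negPf (h u)). Qed.

(** For z != 0 the inner count does not depend on z, because - z^3 is a cube.
    Together with the symmetry of [affine_solutions] this relates the values of
    [nsol2] at different coefficients. *)
Lemma affine_solutionsE a b c :
  affine_solutions a b c = (nsol2 a b 0%R + #|K|.-1 * nsol2 a b c)%N.
Proof.
have -> : affine_solutions a b c = (\sum_z nsol2 a b (- c * z ^+ 3)%R)%N.
  rewrite /affine_solutions /nsol2 exchange_big [RHS]exchange_big /= exchange_big /=.
  apply: eq_bigr => x _; rewrite [RHS]exchange_big /=; apply: eq_bigr => y _.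
  by apply: eq_bigr => z _; rewrite mulNr -addr_eq0.
rewrite (bigD1 0) //= expr0n mulr0; congr (_ + _)%N.
rewrite (eq_bigr (fun=> nsol2 a b c)) => [|z z0]; last first.
  rewrite nsol2_cuber //; have N1 : (-1) != 0 :> K by rewrite oppr_eq0 oner_eq0.
  by rewrite -(nsol2_cuber _ _ c N1) -signr_odd expr1 mulrN1.
by rewrite sum_nat_const -card_neq0.
Qed.

Lemma affine_solutionsC a b c : affine_solutions a b c = affine_solutions a c b.
Proof.
rewrite /affine_solutions; apply: eq_bigr => x _; rewrite exchange_big.
by apply: eq_bigr => y _; apply: eq_bigr => z _; rewrite addrAC.
Qed.

Lemma affine_solutions_cube t a b c : t != 0 ->
  affine_solutions (a * t ^+ 3) b c = affine_solutions a b c.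
Proof. by move=> t0; rewrite !affine_solutionsE !nsol2_cubel. Qed.

Lemma affine_solutionsCA a b c : affine_solutions a b c = affine_solutions b a c.
Proof.
rewrite /affine_solutions exchange_big /=; apply: eq_bigr => x _.
by apply: eq_bigr => y _; apply: eq_bigr => z _; rewrite (addrC (a * _)).
Qed.

(** For a generator g of the multiplicative group and #|K| = 1 mod 3, the nonzero
    elements split into the three cubic classes of 1, g and g^2. *)
Section Classes.
Variable g : K.
Hypothesis g0 : g != 0.
Hypothesis ggen : forall y, y != 0 -> exists k, y = g ^+ k.
Hypothesis gord : forall j, (g ^+ j == 1) = (#|K|.-1 %| j)%N.
Hypothesis K3 : (3 %| #|K|.-1)%N.

Let K1 := card_pred_gt0 K.

Lemma cubic_class y : y = 0 \/
  exists2 t, t != 0 & [\/ y = t ^+ 3, y = g * t ^+ 3 | y = g ^+ 2 * t ^+ 3].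
Proof.
have [->|/ggen[k ->]] := eqVneq y 0; [by left | right].
exists (g ^+ (k %/ 3)); first by rewrite expf_neq0.
rewrite -exprM {1 3 5}(divn_eq k 3) exprD mulrC.
have : (k %% 3 < 3)%N by rewrite ltn_mod.
case: (k %% 3)%N => [|[|[|//]]] _; rewrite ?mul1r ?expr1.
- by apply: Or31.
- by apply: Or32.
- by apply: Or33.
Qed.

(** Cubes have trivial (#|K| - 1)/3-th power. *)
Lemma gen_not_cube k t : (k %% 3 != 0)%N -> t ^+ 3 != g ^+ k.
Proof.
rewrite -/(dvdn 3 k); apply: contraNneq => E.
have t0 : t != 0.
  by apply: contraTneq (expf_neq0 k g0) => t0; rewrite -E t0 expr0n eqxx.
have : g ^+ (k * (#|K|.-1 %/ 3)) == 1.
  have [j Et] := ggen t0.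
  by rewrite exprM -E Et -!exprM gord -?mulnA [(3 * _)%N]mulnC divnK ?dvdn_mull.
rewrite gord -{1}(divnK K3) [(k * _)%N]mulnC dvdn_pmul2l //.
by rewrite divn_gt0 // dvdn_leq.
Qed.

(** The cube roots of 1 are the powers of w = g^((#|K| - 1)/3). *)
Lemma nsol1_class0 t : t != 0 -> nsol1 1 (t ^+ 3) = 3%N.
Proof.
move=> t0; rewrite -[t ^+ 3]mul1r nsol1_cuber //.
pose w := g ^+ (#|K|.-1 %/ 3).
have w3 : w ^+ 3 = 1 by apply/eqP; rewrite -exprM divnK // gord.
have w1 : w != 1.
  rewrite gord; apply/negP => /dvdn_leq; rewrite divn_gt0 // dvdn_leq // => /(_ isT).
  by rewrite leqNgt ltn_Pdiv.
have w2 : w ^+ 2 + w + 1 = 0.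
  apply/eqP; move/eqP: w3; rewrite -subr_eq0.
  have -> : w ^+ 3 - 1 = (w - 1) * (w ^+ 2 + w + 1) by ring.
  by rewrite mulf_eq0 subr_eq0 (negPf w1).
have w0 : w != 0 by rewrite expf_neq0.
transitivity #|[set 1; w; w ^+ 2]|.
  rewrite -sum1_card [RHS]big_mkcond /=; apply: eq_bigr => u _.
  rewrite mul1r !inE -subr_eq0.
  have -> : u ^+ 3 - 1 = (u - 1) * (u - w) * (u - w ^+ 2).
    have -> : (u - 1) * (u - w) * (u - w ^+ 2) =
      u ^+ 3 - (w ^+ 2 + w + 1) * u ^+ 2 + (w + w ^+ 2 + w ^+ 3) * u - w ^+ 3 by ring.
    by rewrite w3 w2 [w + _]addrC w2; ring.
  by rewrite !mulf_eq0 !subr_eq0; case: (_ || _).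
have w12 : w != w ^+ 2.
  by rewrite expr2 -{1}[w]mulr1 (inj_eq (mulfI w0)) eq_sym.
have w21 : 1 != w ^+ 2.
  by apply: contraNneq w1 => E; rewrite -w3 exprSr -E mul1r.
by rewrite setUC cardsU1 cards2 !inE ![_ == w]eq_sym [_ == 1]eq_sym (negPf w12) (negPf w21) w1.
Qed.

Lemma nsol1_gen k t : t != 0 ->
  nsol1 1 (g ^+ k * t ^+ 3) = (if 3 %| k then 3 else 0)%N.
Proof.
move=> t0; rewrite nsol1_cuber //; case: ifPn => [/dvdnP[j ->]|k3].
  by rewrite exprM nsol1_class0 // expf_neq0.
by rewrite nsol1_eq0 // => s; rewrite mul1r gen_not_cube.
Qed.

(** Scaling by g^(2i) turns the coefficient g^i into the cube g^(3i). *)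
Lemma nsol1_gen_gen i k t : t != 0 ->
  nsol1 (g ^+ i) (g ^+ k * t ^+ 3) = (if 3 %| 2 * i + k then 3 else 0)%N.
Proof.
move=> t0; rewrite -(nsol1_gen _ t0) -(nsol1_scale _ _ (expf_neq0 (2 * i) g0)).
rewrite mulrA -!exprD -(nsol1_cubel 1 _ (expf_neq0 i g0)) mul1r -exprM.
by congr (nsol1 (g ^+ _) _); lia.
Qed.

Lemma nsol1_sum y : (nsol1 1 y + nsol1 g y + nsol1 (g ^+ 2) y)%N = 3%N.
Proof.
have [->|[t t0 Ey]] := cubic_class y; first by rewrite !nsol1_0 ?expf_neq0 ?oner_eq0.
have {Ey}[k k3 ->] : exists2 k, (k < 3)%N & y = g ^+ k * t ^+ 3.
  case: Ey => ->; [exists 0%N | exists 1%N | exists 2%N] => //.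
  by rewrite expr0 mul1r.
have := nsol1_gen_gen 1 k t0; rewrite expr1 => ->.
by rewrite nsol1_gen // nsol1_gen_gen //; case: k k3 => [|[|[|]]].
Qed.

(** By [nsol1_sum] the maps u |-> u^3, g u^3, g^2 u^3 together cover every element
    of K exactly three times. *)
Lemma sum_cube_invariant (h : K -> nat) :
  (forall y t, t != 0 -> h (y * t ^+ 3) = h y) ->
  (3 * \sum_y h y = 3 * h 0%R + #|K|.-1 * (h 1%R + h g + h (g ^+ 2)%R))%N.
Proof.
move=> hc.
have H a : (\sum_y h y * nsol1 a y = h 0%R + #|K|.-1 * h a)%N.
  transitivity (\sum_u h (a * u ^+ 3)%R)%N.
    rewrite /nsol1; under eq_bigr do rewrite big_distrr /=.
    rewrite exchange_big; apply: eq_bigr => u _ /=.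
    rewrite (bigD1 (a * u ^+ 3)) //= eqxx muln1 big1 ?addn0 // => y /negPf.
    by rewrite eq_sym => ->; rewrite muln0.
  rewrite (bigD1 0) //= expr0n mulr0; congr (_ + _)%N.
  under eq_bigr => u u0 do rewrite hc //.
  by rewrite sum_nat_const -card_neq0.
rewrite mulnC big_distrl /=.
under eq_bigr => y _ do rewrite -(nsol1_sum y) !mulnDr.
rewrite !big_split /= !H.
by move: (h 0) (h 1) (h g) (h (g ^+ 2)) #|K|.-1 => *; nia.
Qed.

Lemma sum_nsol2 a b : (\sum_y nsol2 a b y = #|K| ^ 2)%N.
Proof.
rewrite /nsol2 exchange_big /=.
under eq_bigr => u _.
  rewrite exchange_big /=.
  under eq_bigr => v _.
    rewrite (bigD1 (a * u ^+ 3 + b * v ^+ 3)) //= eqxx big1 ?addn0; last first.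
      by move=> y /negPf; rewrite eq_sym => ->.
    over.
  rewrite sum_nat_const muln1; over.
by rewrite sum_nat_const mulnn.
Qed.

Lemma nsol2_1_1_0 : nsol2 1 1 0 = (1 + 3 * #|K|.-1)%N.
Proof.
rewrite nsol2E1 (bigD1 0) //= expr0n mulr0 subr0 nsol1_0 ?oner_eq0 //.
congr (_ + _)%N.
rewrite (eq_bigr (fun=> 3%N)) => [|v v0].
  by rewrite sum_nat_const mulnC -card_neq0.
have -> : 0 - 1 * v ^+ 3 = (- v) ^+ 3 by ring.
by rewrite nsol1_class0 // oppr_eq0.
Qed.

Lemma nsol2_1_g_0 : nsol2 1 g 0 = 1%N.
Proof.
rewrite nsol2E1 (bigD1 0) //= expr0n mulr0 subr0 nsol1_0 ?oner_eq0 //.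
rewrite big1 // => v v0.
have -> : 0 - g * v ^+ 3 = g ^+ 1 * (- v) ^+ 3 by ring.
by rewrite nsol1_gen // oppr_eq0.
Qed.

(** When p = 2 mod 3 the Frobenius map swaps the classes of g and g^2.  This extra
    symmetry leaves a single unknown among the counts [nsol2]. *)
Section Frobenius.
Variable p : nat.
Hypothesis pK : p \in [pchar K].
Hypothesis p2 : (p %% 3 = 2)%N.

Lemma nsol2_frob a b y : nsol2 (a ^+ p) (b ^+ p) (y ^+ p) = nsol2 a b y.
Proof.
have inj : injective (fun x : K => x ^+ p) := fmorph_inj (pFrobenius_aut pK).
rewrite /nsol2 (reindex_inj inj) /=; apply: eq_bigr => u _.
rewrite (reindex_inj inj) /=; apply: eq_bigr => v _.
rewrite -!exprM ![(p * 3)%N]mulnC !exprM -!exprMn.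
have -> : (a * u ^+ 3) ^+ p + (b * v ^+ 3) ^+ p = (a * u ^+ 3 + b * v ^+ 3) ^+ p.
  by rewrite -!(pFrobenius_autE pK) -rmorphD.
by rewrite (inj_eq inj).
Qed.

Lemma gen_frob : exists2 t, t != 0 & g ^+ p = g ^+ 2 * t ^+ 3.
Proof.
exists (g ^+ (p %/ 3)); first by rewrite expf_neq0.
by rewrite -exprM -exprD {1}(divn_eq p 3) p2 addnC.
Qed.

Lemma nsol2_1_1_g2 : nsol2 1 1 (g ^+ 2) = nsol2 1 1 g.
Proof.
have [t t0 E] := gen_frob.
by rewrite -(nsol2_frob 1 1 g) expr1n E nsol2_cuber.
Qed.

Lemma nsol2_1_g2_1 : nsol2 1 (g ^+ 2) 1 = nsol2 1 g 1.
Proof.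
have [t t0 E] := gen_frob.
by rewrite -(nsol2_frob 1 g 1) expr1n E [RHS]nsol2C nsol2_cubel // nsol2C.
Qed.

(** Multiplied by g^2, the equation u^3 + g v^3 = g becomes g^2 u^3 + (g v)^3 = g^3,
    which is cube equivalent to g^2 u^3 + v^3 = 1. *)
Lemma nsol2_1_g_g : nsol2 1 g g = nsol2 1 g 1.
Proof.
rewrite -nsol2_1_g2_1 -(nsol2_scale 1 g g (expf_neq0 2 g0)) mulr1 -exprSr.
rewrite -[in nsol2 _ _ (g ^+ 3)](mul1r (g ^+ 3)) nsol2_cuber //.
by rewrite nsol2C nsol2_cubel.
Qed.

Lemma nsol2_1_g2_g2 : nsol2 1 (g ^+ 2) (g ^+ 2) = nsol2 1 g 1.
Proof.
have [t t0 E] := gen_frob.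
rewrite -nsol2_1_g_g -(nsol2_frob 1 g g) expr1n E nsol2_cuber //.
by rewrite [RHS]nsol2C nsol2_cubel // nsol2C.
Qed.

(** Both counts come from the curve u^3 + v^3 + g w^3 = 0, solved for g w^3 or
    for v^3. *)
Lemma nsol2_1_1_g : (nsol2 1 1 g + 3 = nsol2 1 g 1)%N.
Proof.
have := affine_solutionsC 1 1 g; rewrite !affine_solutionsE nsol2_1_1_0 nsol2_1_g_0.
move=> E; have : (#|K|.-1 * (nsol2 1 1 g + 3) = #|K|.-1 * nsol2 1 g 1)%N by lia.
by move/eqP; rewrite eqn_pmul2l // => /eqP.
Qed.

(** 1 - g v^3 is never 0, and a nonzero element has 0 or 3 cube roots. *)
Lemma dvd3_nsol2_1_g_1 : (3 %| nsol2 1 g 1)%N.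
Proof.
rewrite nsol2E1; apply: dvdn_sum => v _.
have [E|[t t0 [|| ] ->]] := cubic_class (1 - g * v ^+ 3).
- exfalso; have v0 : v != 0.
    by apply: contra_eqN E => /eqP->; rewrite expr0n mulr0 subr0 oner_eq0.
  have : (v^-1) ^+ 3 != g ^+ 1 by apply: gen_not_cube.
  rewrite expr1 exprVn => /eqP; apply.
  by apply: (mulIf (expf_neq0 3 v0)); rewrite mulVf ?expf_neq0 //; apply/eqP; rewrite -subr_eq0 E.
- by rewrite nsol1_class0.
- by rewrite -{1}(expr1 g) nsol1_gen.
- by rewrite nsol1_gen.
Qed.

Let q : int := #|K|%:Z.
Let s0 : int := (nsol2 1 g 1)%:Z.
(** The Fermat cubic has q + 1 - 2 h points, so 2 h is its trace of Frobenius. *)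
Let h : int := s0 - q - 1.

Let qE : #|K|.-1%:Z = q - 1.
Proof. by rewrite /q; move: K1; lia. Qed.

(** The values of [nsol2 1 1] at 0, 1, g and g^2 are tied by its sum q^2 over K. *)
Lemma nsol2_1_1_1 : (nsol2 1 1 1)%:Z = q - 2 - 2 * h.
Proof.
have := sum_cube_invariant (fun y t => nsol2_cuber 1 1 y (t := t)).
rewrite sum_nsol2 nsol2_1_1_g2 nsol2_1_1_0; have := nsol2_1_1_g; have := qE; have := K1.
rewrite /h /s0 /q; nia.
Qed.

Lemma nsol2_1_g_g2 : (nsol2 1 g (g ^+ 2))%:Z = s0 - 3 * h.
Proof.
have := sum_cube_invariant (fun y t => nsol2_cuber 1 g y (t := t)).
rewrite sum_nsol2 nsol2_1_g_g nsol2_1_g_0; have := qE; have := K1.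
rewrite /h /s0 /q; nia.
Qed.

(** [nsol2 1 1] and [nsol2 1 g] are combinations of the indicator of 0, a constant,
    and the number of cube roots of y, respectively of y / g^2.  Read as convolutions
    of functions on K, these formulas are the multiplication rules of the algebra
    spanned by the cubic classes. *)
Lemma nsol2_1_1E y :
  (nsol2 1 1 y)%:Z = 2 * q * (y == 0)%:Z - h * (nsol1 1 y)%:Z + (s0 - 3).
Proof.
have := nsol2_1_1_g; have := nsol2_1_1_1; have := qE => Hq H1 H2.
have [->|[t t0 [|| ] ->]] := cubic_class y.
- rewrite eqxx nsol2_1_1_0 nsol1_0 ?oner_eq0 // /h; lia.
- rewrite expf_eq0 (negPf t0) /= nsol1_class0 // -[t ^+ 3]mul1r nsol2_cuber //.
  rewrite H1 /h; lia.
- rewrite mulf_eq0 expf_eq0 (negPf g0) (negPf t0) /=.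
  rewrite -{2}(expr1 g) nsol1_gen // nsol2_cuber // /h /s0; have -> : (3 %| 1)%N = false by []; lia.
- rewrite mulf_eq0 !expf_eq0 (negPf g0) (negPf t0) /=.
  rewrite nsol1_gen // nsol2_cuber // nsol2_1_1_g2 /h /s0; have -> : (3 %| 2)%N = false by []; lia.
Qed.

Lemma nsol2_1_gE y :
  (nsol2 1 g y)%:Z = - q * (y == 0)%:Z - h * (nsol1 (g ^+ 2) y)%:Z + s0.
Proof.
have := nsol2_1_g_g2; have := qE => Hq H1.
have [->|[t t0 [|| ] ->]] := cubic_class y.
- rewrite eqxx nsol2_1_g_0 nsol1_0 ?expf_neq0 // /h; lia.
- rewrite expf_eq0 (negPf t0) /= -[t ^+ 3]mul1r nsol2_cuber //.
  rewrite -[X in nsol1 _ (X * _)](expr0 g) nsol1_gen_gen // /s0; have -> : (3 %| 2 * 2 + 0)%N = false by []; lia.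
- rewrite mulf_eq0 expf_eq0 (negPf g0) (negPf t0) /=.
  rewrite nsol2_cuber // nsol2_1_g_g -[X in nsol1 _ (X * _)](expr1 g) nsol1_gen_gen // /s0; have -> : (3 %| 2 * 2 + 1)%N = false by []; lia.
- rewrite mulf_eq0 !expf_eq0 (negPf g0) (negPf t0) /=.
  rewrite nsol1_gen_gen // nsol2_cuber // H1; have -> : (3 %| 2 * 2 + 2)%N = true by []; lia.
Qed.

(** Associativity of convolution: the solutions of u^3 + v^3 + g w^3 = g^2 are
    counted with w, or with u, as the last variable.  The two formulas above
    evaluate the counts as - h (s0 - 3 h) + q (s0 - 3) and - h s0 + q s0, whose
    difference is 3 (h^2 - q).  The target g^2 keeps the indicator of 0 silent,
    since neither g^2 - g w^3 nor g^2 - u^3 vanishes. *)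
Lemma sqr_half_trace : h ^+ 2 = q.
Proof.
have D : \sum_w (nsol2 1 1 (g ^+ 2 - g * w ^+ 3))%:Z =
         \sum_u (nsol2 1 g (g ^+ 2 - 1 * u ^+ 3))%:Z.
  rewrite -!(big_morph Posz PoszD (erefl _)); congr Posz; rewrite /nsol2.
  rewrite exchange_big; apply: eq_bigr => u _ /=.
  rewrite exchange_big; apply: eq_bigr => v _ /=.
  apply: eq_bigr => w _; congr nat_of_bool; rewrite -[LHS]subr_eq0 -[RHS]subr_eq0.
  by congr (_ == 0); ring.
have A : \sum_w (nsol2 1 1 (g ^+ 2 - g * w ^+ 3))%:Z = - h * (s0 - 3 * h) + q * (s0 - 3).
  under eq_bigr => w _ do rewrite nsol2_1_1E.
  rewrite 2!big_split /= sumr_const -mulr_sumr sumrN -mulr_sumr.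
  rewrite -!(big_morph Posz PoszD (erefl _)) -nsol2E1 nsol2_1_g_g2.
  rewrite big1 ?mulr0 ?add0r => [|w _]; last first.
    case: eqP => // /eqP; rewrite subr_eq0 expr2 (inj_eq (mulfI g0)) eq_sym -{1}(expr1 g).
    by rewrite (negPf (gen_not_cube _ _)).
  by rewrite mulNr; congr (_ + _); rewrite -[LHS]mulr_natl natz.
have B : \sum_u (nsol2 1 g (g ^+ 2 - 1 * u ^+ 3))%:Z = - h * s0 + q * s0.
  under eq_bigr => u _ do rewrite nsol2_1_gE.
  rewrite 2!big_split /= sumr_const -mulr_sumr sumrN -mulr_sumr.
  rewrite -!(big_morph Posz PoszD (erefl _)) -nsol2E1 nsol2C nsol2_1_g2_g2.
  rewrite big1 ?mulr0 ?add0r => [|w _]; last first.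
    case: eqP => // /eqP; rewrite subr_eq0 mul1r eq_sym.
    by rewrite (negPf (gen_not_cube _ _)).
  by rewrite mulNr; congr (_ + _); rewrite -[LHS]mulr_natl natz.
move: D; rewrite A B; nia.
Qed.

End Frobenius.
End Classes.
End CubicCounts.

(** * Maximality and minimality *)

(** The congruence h = 1 mod 3 selects the sign of the square root h of #|K|. *)
Lemma affine_solutions_supersingular (K : finFieldType) p :
  p \in [pchar K] -> (p %% 3 = 2)%N -> (3 %| #|K|.-1)%N ->
  exists2 h : int, h ^+ 2 = #|K|%:Z /\ (h = 1 %[mod 3])%Z &
    (affine_solutions (1 : K) 1 1)%:Z = 1 + #|K|.-1%:Z * (#|K|%:Z + 1 - 2 * h).
Proof.
move=> pK p2 K3; have [g [g0 ggen gord]] := finField_generator K.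
exists ((nsol2 1 g 1)%:Z - #|K|%:Z - 1); last first.
  rewrite affine_solutionsE (nsol2_1_1_0 g0 gord K3) PoszD [(_ * nsol2 _ _ _)%N%:Z]PoszM.
  by rewrite (nsol2_1_1_1 g0 ggen gord K3 pK p2); lia.
split; first exact: sqr_half_trace pK p2.
have /dvdnP[k ->] := dvd3_nsol2_1_g_1 g0 ggen gord K3.
have [l Kl] := dvdnP K3.
have : (0 < #|K|)%N by apply/card_gt0P; exists 0.
by move: Kl; lia.
Qed.

(** The exponent 2p - 1 is divisible by 3, and a^(2p - 1) = a by Fermat. *)
Lemma Fp_is_cube p (a : 'F_p) : prime p -> (p %% 3 = 2)%N -> exists t, a = t ^+ 3.
Proof.
move=> p_pr p2; exists (a ^+ ((2 * p - 1) %/ 3)); rewrite -exprM.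
have -> : ((2 * p - 1) %/ 3 * 3 = p + p.-1)%N by lia.
have ap : a ^+ p = a by rewrite -{2}[a]expf_card card_Fp.
by rewrite exprD ap -exprS prednK ?prime_gt0.
Qed.

Section RationalPointCriteria.
Variables (K : finFieldType) (F : {mpoly K[3]}) (Q g : nat).
Hypotheses (cK : #|K| = (Q ^ 2)%N) (spc : smooth_plane_curve F g).

Let Q_unique Q' : #|K| = (Q' ^ 2)%N -> Q' = Q.
Proof. by rewrite cK => /eqP; rewrite eqn_exp2r // => /eqP. Qed.

Lemma maximal_curveE : maximal_curve F <->
  #|rational_points F|%:Z = Q%:Z ^+ 2 + 1 + 2 * g%:Z * Q%:Z.
Proof.
split=> [[Q' [g' [/Q_unique-> spc' ->]]]|E]; last by exists Q, g; split.
by rewrite (genus_unique (spc_genus spc') (spc_genus spc)).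
Qed.

Lemma minimal_curveE : minimal_curve F <->
  #|rational_points F|%:Z = Q%:Z ^+ 2 + 1 - 2 * g%:Z * Q%:Z.
Proof.
split=> [[Q' [g' [/Q_unique-> spc' ->]]]|E]; last by exists Q, g; split.
by rewrite (genus_unique (spc_genus spc') (spc_genus spc)).
Qed.

End RationalPointCriteria.

Section CubicOverPrimeField.
Variables (p : nat) (a b c : 'F_p) (n : nat) (K : finFieldType).
Variable iota : {rmorphism 'F_p -> K}.
Hypotheses (p_pr : prime p).
Hypotheses (a0 : a != 0) (b0 : b != 0) (c0 : c != 0).
Hypotheses (cK : #|K| = (p ^ (2 * n))%N).

Let C := map_mpoly iota (diagonal_cubic a b c).

Let pK : p \in [pchar K]. Proof. exact: card_finPcharP cK p_pr. Qed.

Lemma smooth_C : p <> 3%N -> smooth_plane_curve C 1.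
Proof.
move=> p3; rewrite /C map_diagonal_cubic.
apply: smooth_diagonal_cubic; rewrite ?fmorph_eq0 //.
by rewrite -(dvdn_pcharf pK) dvdn_prime2 //; apply/eqP.
Qed.

Lemma affine_C : affine_solutions (iota a) (iota b) (iota c) =
  (1 + #|K|.-1 * #|rational_points C|)%N.
Proof. by rewrite card_rational_points /C map_diagonal_cubic. Qed.

(** A maximal or minimal curve has 1 mod p points, since p divides Q. *)
Lemma card_C_ordinary : (p %% 3 = 1)%N -> #|rational_points C|%:R != 1 :> K.
Proof.
move=> p1; have := @affine_solutions_ordinary K (iota a) (iota b) (iota c) p _ p_pr p1 cK.
rewrite !fmorph_eq0 affine_C natrD natrM natr_card_pred mulN1r subr_eq0 [1 == _]eq_sym.
by apply.
Qed.

(** The coefficients are cubes in 'F_p, so C is isomorphic to the Fermat cubic. *)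
Lemma card_C_supersingular : (p %% 3 = 2)%N ->
  exists2 h : int, h ^+ 2 = (p ^ n)%:Z ^+ 2 /\ (h = 1 %[mod 3])%Z &
    #|rational_points C|%:Z = (p ^ n)%:Z ^+ 2 + 1 - 2 * h.
Proof.
move=> p2.
have K3 : (3 %| #|K|.-1)%N.
  rewrite -subn1 -eqn_mod_dvd; last by apply/card_gt0P; exists 0.
  by rewrite cK expnM -modnXm -[(p ^ 2 %% 3)%N]modnXm p2 exp1n.
have [h [h2 h1] E] := affine_solutions_supersingular pK p2 K3.
have cKz : #|K|%:Z = (p ^ n)%:Z ^+ 2 by rewrite cK mulnC expnM PoszM.
exists h; first by rewrite h2 cKz.
rewrite -cKz; have := affine_C.
have [[t ta] [u ub] [v vc]] :
    [/\ exists t, a = t ^+ 3, exists u, b = u ^+ 3 & exists v, c = v ^+ 3].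
  by split; apply: Fp_is_cube.
have t0 : iota t != 0 by rewrite fmorph_eq0; apply: contraNneq a0 => z; rewrite ta z expr0n.
have u0 : iota u != 0 by rewrite fmorph_eq0; apply: contraNneq b0 => z; rewrite ub z expr0n.
have v0 : iota v != 0 by rewrite fmorph_eq0; apply: contraNneq c0 => z; rewrite vc z expr0n.
rewrite ta ub vc !rmorphXn -[iota t ^+ 3]mul1r -[iota u ^+ 3]mul1r -[iota v ^+ 3]mul1r.
rewrite affine_solutions_cube // affine_solutionsCA affine_solutions_cube //.
rewrite affine_solutionsC affine_solutionsCA affine_solutions_cube //.
move=> F; have K1 := card_pred_gt0 K.
move: E; rewrite F PoszD PoszM => /addrI E.
by apply: (@mulfI _ #|K|.-1%:Z) => //; rewrite eqz_nat -lt0n.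
Qed.

End CubicOverPrimeField.

Theorem theorem7p2 (p : nat) (hp : prime p) (hodd : odd p) (hp3 : p <> 3%N)
    (a b c : 'F_p) (ha : a != 0) (hb : b != 0) (hc : c != 0)
    (n : nat) (hn : (1 <= n)%N)
    (K : finFieldType) (hK : #|K| = (p ^ (2 * n))%N)
    (iota : {rmorphism 'F_p -> K}) :
  let C := map_mpoly iota (diagonal_cubic a b c) in
  (maximal_curve C <-> (3 %| p ^ n + 1)%N) /\
  (minimal_curve C <-> (3 %| p ^ n - 1)%N /\ p = 2 %[mod 3]).
Proof.
move=> C.
have hK2 : #|K| = ((p ^ n) ^ 2)%N by rewrite hK mulnC expnM.
have spC := smooth_C iota hp ha hb hc hK hp3.
rewrite (maximal_curveE hK2 spC) (minimal_curveE hK2 spC) -/C mulr1.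
set N := #|_|; set Q := (p ^ n)%N.
have Q0 : (0 < Q)%N by rewrite expn_gt0 prime_gt0.
have p0 : (p %% 3 != 0)%N.
  by rewrite -/(dvdn 3 p) dvdn_prime2 // eq_sym; apply/eqP.
have [p1|p2] : (p %% 3 = 1)%N \/ (p %% 3 = 2)%N by move: p0; lia.
  have Q1 : (Q %% 3 = 1)%N by rewrite /Q -modnXm p1 exp1n.
  have QK : Q%:R = 0 :> K.
    apply/eqP; rewrite -(dvdn_pcharf (card_finPcharP hK hp)) /Q.
    by rewrite -{1}[p]expn1 dvdn_exp2l.
  have NK := card_C_ordinary iota hp ha hb hc hK p1; rewrite -/C -/N in NK.
  split; split; try by [move=> H; exfalso; lia].
    move=> E; case/negP: NK.
    have -> : N = (Q * (Q + 2) + 1)%N by move: E; rewrite expr2; nia.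
    by rewrite natrD natrM QK mul0r add0r.
  move=> E; case/negP: NK; rewrite -[N%:R]addr0 -[0](mulr0 2%:R) -QK -natrM -natrD.
  have -> : (N + 2 * Q = Q * Q + 1)%N by move: E; rewrite expr2; nia.
  by rewrite natrD natrM QK mul0r add0r.
have [h [h2 h1] ->] := card_C_supersingular iota hp ha hb hc hK p2.
rewrite -/Q in h2 *.
have /orP[/eqP hQ|/eqP hQ] : (h == Q%:Z) || (h == - Q%:Z) by rewrite -eqf_sqr h2.
- have Q1 : (Q %% 3 = 1)%N by move: h1; rewrite hQ; lia.
  by split; split; lia.
- have Q1 : (Q %% 3 = 2)%N by move: h1; rewrite hQ; lia.
  by split; split; lia.
Qed.
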